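(* Let $(\mathcal{M},R,\mathcal{Y},\mathcal{O},T_1(S))$ be a framework (as defined in the context). Assume $T(S)$ is equicontinuous and compatible with some partial order $P$ on $\mathcal{Y}$. If $P$ satisfies the topological descending chain condition then $$\mathrm{Irr}(S)=\mathrm{Cspan}\bigl(\{\mu\in\mathcal{Y}: t(\mu)=\mu\text{ for all }t\in T_1(S)\}\bigr).$$
   Context: Framework. $\mathcal{M}$ is an abelian group (written additively); $R$ is a set of group endomorphisms of $\mathcal{M}$. A subgroup $N$ is called an $R$-module if $r(a)\in N$ for all $a\in N$, $r\in R$. $\mathcal{Y}\subseteq\mathcal{M}$ is such that the only $R$-module $N\subseteq\mathcal{M}$ with $\mathcal{Y}\subseteq N$ is $\mathcal{M}$ itself. $\mathcal{O}=\{B_n\}_{n=1}^\infty$ is a family of $R$-modules in $\mathcal{M}$ with $B_n\supseteq B_{n+1}$ and $\bigcap_n B_n=\{0\}$. $\mathcal{M}$ carries the group topology for which $\mathcal{O}$ is a fundamental system of neighbourhoods of $0$; $\overline{\mathcal{M}}\supseteq\mathcal{M}$ is its completion, overlines denote closure in $\overline{\mathcal{M}}$, and $\widehat{\mathcal{O}}=\{\overline{B_n}\}_{n=1}^\infty$, which is a fundamental system of neighbourhoods of $0$ in $\overline{\mathcal{M}}$. The group operations and the elements of $R$ are extended by continuity to $\overline{\mathcal{M}}$, and $R$-modules in $\overline{\mathcal{M}}$ are defined in the same way. $\mathrm{Span}(Z)$ is the smallest $R$-module containing $Z\subseteq\overline{\mathcal{M}}$, and $\mathrm{Cspan}(Z)=\overline{\mathrm{Span}(Z)}$.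 $T_1(S)$ (''simple reductions''; $S$ is just a label) is a set of continuous group homomorphisms $\overline{\mathcal{M}}\to\overline{\mathcal{M}}$, each satisfying $t\circ r=r\circ t$ for all $r\in R$. $T(S)$ (''reductions'') is the set of all finite compositions of elements of $T_1(S)$, including the identity. $\mathrm{Irr}(S)=\{a\in\overline{\mathcal{M}}: t(a)=a\ \forall t\in T(S)\}$. A set $F$ of group homomorphisms $\overline{\mathcal{M}}\to\overline{\mathcal{M}}$ is equicontinuous if for every $\varepsilon\in\widehat{\mathcal{O}}$ there is $\delta\in\widehat{\mathcal{O}}$ with $f(\delta)\subseteq\varepsilon$ for all $f\in F$. ''$\nu<\mu$ in $P$'' is the strict relation of $P$. $P$ satisfies the topological descending chain condition if every infinite sequence $\{\mu_n\}_{n=0}^\infty\subseteq\mathcal{Y}$ with $\mu_n>\mu_{n+1}$ in $P$ for all $n$ satisfies $\lim_n\mu_n=0$. $\mathrm{DSM}(\mu,P)=\mathrm{Cspan}(\{\nu\in\mathcal{Y}:\nu<\mu\text{ in }P\})$. A reduction $t$ is compatible with $P$ if $t(\mu)\in\{\mu\}\cup\mathrm{DSM}(\mu,P)$ for all $\mu\in\mathcal{Y}$; a set of reductions is compatible with $P$ if all its elements are. *)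

(* Defs.v *)
From HB Require Import structures.
From mathcomp Require Import all_boot all_order all_algebra.
From mathcomp Require Import all_classical all_reals all_analysis.

Set Implicit Arguments.
Unset Strict Implicit.
Unset Printing Implicit Defensive.

Import GRing.Theory.
Local Open Scope classical_set_scope.
Local Open Scope ring_scope.

Definition is_Rmodule (V : zmodType) (R : set (V -> V)) (N : set V) : Prop :=
  [/\ N 0, forall a b, N a -> N b -> N (a - b)
    & forall r a, R r -> N a -> N (r a)].

(* [nbhs 0] determines the whole (group) topology of [M]. *)
Definition fundamental_system (M : topologicalZmodType) (B : nat -> set M) :
  Prop := nbhs (0 : M) = filter_from [set: nat] B.

(* [iota] exhibits [Mb] as the Hausdorff completion of [M]. The uniformity of a
   [UniformZmodule] is the one of its underlying topological group, since
   subtraction is uniformly continuous. The library's [completeType] also asks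
   for a pointed structure, hence the explicit completeness clause. *)
Record is_completion (M : topologicalZmodType) (Mb : UniformZmodule.type)
    (iota : {additive M -> Mb}) : Prop := IsCompletion {
  completion_hausdorff : hausdorff_space Mb;
  completion_complete : forall F : set_system Mb,
    ProperFilter F -> cauchy F -> exists l : Mb, F --> l;
  completion_inj : injective iota;
  completion_initial : @open M = [set iota @^-1` V | V in @open Mb];
  completion_dense : dense (range iota) }.

Section Framework.
Context (M : topologicalZmodType) (Mb : UniformZmodule.type).
Variable iota : {additive M -> Mb}.
Variables (R : set (M -> M)) (Y : set M) (B : nat -> set M).
Variable T1 : set (Mb -> Mb).

(* The extensions by continuity of the elements of [R]. Each [r] in [R] maps
   every [B n] into itself, so it has exactly one such extension. *)
Definition extR : set (Mb -> Mb) :=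
  [set rb | continuous rb /\
            exists2 r, R r & forall x, rb (iota x) = iota (r x)].

(* The family of neighbourhoods is indexed from 0 instead of 1. *)
Record framework : Prop := Framework {
  fw_R : forall r, R r -> zmod_morphism r;
  fw_Y : forall N, is_Rmodule R N -> Y `<=` N -> N = [set: M];
  fw_B : forall n, is_Rmodule R (B n);
  fw_B_decr : forall n, B n.+1 `<=` B n;
  fw_B_cap : \bigcap_n B n = [set 0];
  fw_top : fundamental_system B;
  fw_completion : is_completion iota;
  fw_T1_morph : forall t, T1 t -> zmod_morphism t;
  fw_T1_cont : forall t, T1 t -> continuous t;
  fw_T1_comm : forall t rb, T1 t -> extR rb -> t \o rb = rb \o t }.

Definition Bhat (n : nat) : set Mb := closure (iota @` B n).

Definition Span (Z : set Mb) : set Mb := smallest (is_Rmodule extR) Z.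

Definition Cspan (Z : set Mb) : set Mb := closure (Span Z).

Inductive reductions : set (Mb -> Mb) :=
| red_id : reductions id
| red_comp t u : T1 t -> reductions u -> reductions (t \o u).

Definition Irr : set Mb := [set a | forall t, reductions t -> t a = a].

Definition equicontinuous_family (F : set (Mb -> Mb)) : Prop :=
  forall n, exists m, forall f, F f -> f @` Bhat m `<=` Bhat n.

(* A relation on [M] of which only the restriction to [Y] matters. *)
Record partial_order_on (le : M -> M -> Prop) : Prop := PartialOrderOn {
  po_refl : forall a, Y a -> le a a;
  po_anti : forall a b, Y a -> Y b -> le a b -> le b a -> a = b;
  po_trans : forall a b c, Y a -> Y b -> Y c -> le a b -> le b c -> le a c }.

Definition strict (le : M -> M -> Prop) (a b : M) : Prop := le a b /\ a <> b.

Definition topological_dcc (le : M -> M -> Prop) : Prop :=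
  forall mu : nat -> M, (forall n, Y (mu n)) ->
    (forall n, strict le (mu n.+1) (mu n)) -> mu @ \oo --> (0 : M).

Definition DSM (le : M -> M -> Prop) (mu : M) : set Mb :=
  Cspan (iota @` [set nu | Y nu /\ strict le nu mu]).

Definition compatible (le : M -> M -> Prop) (t : Mb -> Mb) : Prop :=
  forall mu, Y mu -> ([set iota mu] `|` DSM le mu) (t (iota mu)).

End Framework.

(* Main.v *)
(** Fix [n] and let [V] be the set of elements all of whose reducts lie in the
    [n]-th basic neighbourhood of 0. It is an [R]-module, stable under
    reductions and, by equicontinuity, open. Let [I] be the span of the
    irreducible elements of [Y], and call [b] reducible if every reduct of [b]
    can be further reduced into [I + V]. Reducible elements form an open, hence
    closed, [R]-module; so by compatibility every non-reducible element of [Y]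
    has a strictly smaller one. Descending, one gets a chain of non-reducible
    elements which converges to 0 and thus enters [V]; but [V] consists of
    reducible elements. Hence everything is reducible, and an element of
    [Irr(S)], being its own only reduct, lies in [I + V] for every [n]. *)

Require Import Defs.
From HB Require Import structures.
From mathcomp Require Import all_boot all_order all_algebra.
From mathcomp Require Import all_classical all_reals all_analysis.

Import GRing.Theory.

Set Implicit Arguments.
Unset Strict Implicit.
Unset Printing Implicit Defensive.

Local Open Scope classical_set_scope.
Local Open Scope ring_scope.

(** * Preliminaries on uniform abelian groups and on compositions of reductions *)

Lemma subrACA (V : zmodType) (a b c d : V) :
  (a - b) - (c - d) = (a - c) - (b - d).
Proof. by rewrite !opprD !opprK addrACA. Qed.

Lemma unif_continuous2 (U V W : uniformType) (f : U * V -> W) :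
  unif_continuous f -> forall E, entourage E ->
  exists E1 E2, [/\ entourage E1, entourage E2 & forall x x' y y',
    E1 (x, x') -> E2 (y, y') -> E (f (x, y), f (x', y'))].
Proof.
move=> fc E /fc[[E1 E2] /= [E1e E2e] E12]; exists E1, E2.
split=> // x x' y y' Ex Ey.
have /E12[[[a a'] [b b']] /= Ef e] : (E1 `*` E2) ((x, x'), (y, y')) by [].
by move: e Ef => [-> -> -> ->].
Qed.

(** Translating by [x] is uniform in [x]: uniform continuity of addition carries [(0, y - x)] to
    [(x, y)], that of subtraction carries [(x, y)] back. *)
Lemma entourage_nbhs0 (V : UniformZmodule.type) (E : set (V * V)) :
  entourage E <->
  exists2 U, nbhs (0 : V) U & forall x y, U (y - x) -> E (x, y).
Proof.
split=> [/(unif_continuous2 (@add_unif_continuous V))|[U]].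
  move=> [E1 [E2 [E1e E2e E12]]].
  exists (xsection E1 0); first exact: nbhs_entourage.
  move=> x y /xsectionP E1yx.
  by have := E12 _ _ _ _ E1yx (entourage_refl x E2e); rewrite /= add0r subrK.
rewrite -nbhs_entourageE => -[E' E'e E'U] UE.
have [E1 [E2 [E1e E2e E12]]] := unif_continuous2 (@sub_unif_continuous V) E'e.
apply: filterS E1e => -[x y] E1xy; apply/UE/E'U/xsectionP.
by have := E12 _ _ _ _ E1xy (entourage_refl x E2e); rewrite /= subrr.
Qed.

Lemma nbhs_translate (V : UniformZmodule.type) (y : V) (W : set V) :
  nbhs y W <-> exists2 U, nbhs (0 : V) U & forall z, U (z - y) -> W z.
Proof.
split.
  rewrite -{1}nbhs_entourageE => -[E /entourage_nbhs0[U U0 UE] EW].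
  by exists U => // z /UE Ez; apply/EW/xsectionP.
move=> [U U0 UW]; rewrite -nbhs_entourageE.
exists [set xy | U (xy.2 - xy.1)]; first by apply/entourage_nbhs0; exists U.
by move=> z /xsectionP/UW.
Qed.

Lemma reductions_morph (Mb : UniformZmodule.type) (T1 : set (Mb -> Mb))
  (T1_morph : forall t, T1 t -> zmod_morphism t) t :
  reductions T1 t -> zmod_morphism t.
Proof.
elim=> [|{}t u /T1_morph tM _ uM] x y //=.
by rewrite /= uM tM.
Qed.

Lemma reductions_comp (Mb : UniformZmodule.type) (T1 : set (Mb -> Mb)) t u :
  reductions T1 t -> reductions T1 u -> reductions T1 (t \o u).
Proof.
by elim=> [|{}t s Tt _ IH] //= /IH; exact: red_comp.
Qed.

(** * Neighbourhoods of 0 in the completion *)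

Section FrameworkTheory.
Context (M : topologicalZmodType) (Mb : UniformZmodule.type)
  (iota : {additive M -> Mb}) (R : set (M -> M)) (Y : set M)
  (B : nat -> set M) (T1 : set (Mb -> Mb)) (fw : framework iota R Y B T1).
Local Notation Bh := (Bhat iota B).
Local Notation Rb := (extR iota R).
Local Notation T := (reductions T1).

Let B0 n : B n 0. Proof. by have [] := fw_B fw n. Qed.
Let BB n x y : B n x -> B n y -> B n (x - y).
Proof. by have [_ + _] := fw_B fw n; apply. Qed.
Let BR n r x : R r -> B n x -> B n (r x).
Proof. by have [_ _] := fw_B fw n; apply. Qed.

Lemma B_nbhs n : nbhs (0 : M) (B n).
Proof. by rewrite (fw_top fw); exists n. Qed.

Lemma open_iota (U : set M) :
  open U <-> exists2 V, open V & iota @^-1` V = U.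
Proof. by rewrite (completion_initial (fw_completion fw)). Qed.

Lemma iota_continuous : continuous iota.
Proof. by apply/continuousP => A oA; apply/open_iota; exists A. Qed.

(** [B n] contains the trace on [M] of an open [V] around 0, and by density [V] lies in the closure
    of its trace. *)
Lemma Bh_nbhs n : nbhs (0 : Mb) (Bh n).
Proof.
have := B_nbhs n; rewrite nbhsE => -[U [/open_iota[V oV <-] V0] VB].
rewrite nbhsE; exists V; first by split=> //; move: V0; rewrite /= raddf0.
move=> v Vv W; rewrite nbhsE => -[W' [oW' W'v] W'W].
have [|z [[Vz W'z] [x _ xz]]] :=
  @completion_dense _ _ _ (fw_completion fw) (V `&` W') _ (openI oV oW').
  by exists v.
subst; exists (iota x); split; last exact: W'W.
by exists x => //; exact: VB.
Qed.

(** By regularity [W] contains a closed neighbourhood of 0, which absorbs the closure of any [B n]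
    lying in its trace. *)
Lemma Bh_base (W : set Mb) : nbhs 0 W -> exists n, Bh n `<=` W.
Proof.
move=> /(uniform_regular (X := Mb))[W' W'0 W'W].
have : nbhs (0 : M) (iota @^-1` W').
  by apply: iota_continuous; rewrite raddf0.
rewrite (fw_top fw) => -[n _ BW]; exists n => z Bz.
by apply: W'W; apply: closureS Bz => _ [x /BW ? <-].
Qed.

Lemma nbhs_Bh (y : Mb) (W : set Mb) :
  nbhs y W <-> exists n, forall z, Bh n (z - y) -> W z.
Proof.
split.
  move=> /nbhs_translate[U /Bh_base[n nU] UW].
  by exists n => z /nU/UW.
move=> [n nW]; apply/nbhs_translate; exists (Bh n) => //; exact: Bh_nbhs.
Qed.

Lemma closure_Bh (A : set Mb) (y : Mb) :
  closure A y <-> forall n, exists2 a, A a & Bh n (a - y).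
Proof.
split=> [clA n|+ W /nbhs_Bh[n nW]].
  have /clA[a [Aa na]] : nbhs y [set z | Bh n (z - y)].
    by apply/nbhs_Bh; exists n.
  by exists a.
by move=> /(_ n)[a Aa /nW Wa]; exists a.
Qed.

Lemma sub_closed_closure (A : set Mb) :
  (forall a b, A a -> A b -> A (a - b)) ->
  forall a b, closure A a -> closure A b -> closure A (a - b).
Proof.
move=> AB a b /= Aa Ab W /nbhs_translate[U U0 UW].
have : entourage [set xy : Mb * Mb | U (xy.2 - xy.1)].
  by apply/entourage_nbhs0; exists U.
move=> /(unif_continuous2 (@sub_unif_continuous Mb))[U1 [U2 [U1e U2e U12]]].
have [a' [Aa' /xsectionP Ua]] := Aa _ (nbhs_entourage a U1e).
have [b' [Ab' /xsectionP Ub]] := Ab _ (nbhs_entourage b U2e).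
by exists (a' - b'); split; [exact: AB|exact/UW/U12].
Qed.

Lemma Bh0 n : Bh n 0.
Proof. by apply: subset_closure; exists 0; rewrite ?raddf0. Qed.

Lemma BhB n x y : Bh n x -> Bh n y -> Bh n (x - y).
Proof.
apply: sub_closed_closure => _ _ [a Ba <-] [b Bb <-].
by exists (a - b); [exact: BB|rewrite raddfB].
Qed.

Lemma BhN n x : Bh n x -> Bh n (- x).
Proof. by rewrite -[- x]sub0r => Bx; apply: BhB => //; exact: Bh0. Qed.

Lemma BhD n x y : Bh n x -> Bh n y -> Bh n (x + y).
Proof. by move=> Bx /BhN By; rewrite -[y]opprK; exact: BhB. Qed.

Lemma BhC n x y : Bh n (x - y) -> Bh n (y - x).
Proof. by move=> /BhN; rewrite opprB. Qed.

Lemma Bh_trans n x y z : Bh n (x - y) -> Bh n (y - z) -> Bh n (x - z).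
Proof. by rewrite -[x - z](subrKA y); exact: BhD. Qed.

Lemma Bh_decr m n : (m <= n)%N -> Bh n `<=` Bh m.
Proof.
move=> mn; apply: closureS; apply: image_subset.
elim: n mn => [|n IH]; first by rewrite leqn0 => /eqP->.
rewrite leq_eqVlt => /orP[/eqP-> //|/IH].
by apply: subset_trans; exact: fw_B_decr fw n.
Qed.

(** An open subgroup is closed, so taking the closure in [Mb] adds no point of [M] to [B n]. *)
Lemma Bh_iota n x : Bh n (iota x) -> B n x.
Proof.
move=> Bx.
have := B_nbhs n; rewrite nbhsE => -[U [/open_iota[V oV <-] V0] VB].
have : nbhs (iota x) [set z | V (iota x - z)].
  have /Bh_base[m mV] : nbhs (0 : Mb) V.
    by apply: open_nbhs_nbhs; split=> //; move: V0; rewrite /= raddf0.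
  by apply/nbhs_Bh; exists m => z /BhC/mV.
move=> /Bx[_ [[y By <-]] /=]; rewrite -raddfB => /VB /= Bxy.
have -> : x = (x - y) - (0 - y) by rewrite sub0r opprK subrK.
by apply: BB => //; exact: BB.
Qed.

Lemma Bh_eq x y : (forall n, Bh n (x - y)) -> x = y.
Proof.
move=> xy; apply: (completion_hausdorff (fw_completion fw)) => U W Ux Wy.
exists x; split; first exact: nbhs_singleton.
by move: Wy => /nbhs_Bh[n]; apply; exact: xy.
Qed.

Lemma iota_approx y n : exists x, Bh n (y - iota x).
Proof.
have : closure (range iota) y.
  move=> W; rewrite nbhsE => -[W' [oW' W'y] W'W].
  have [|z [W'z Rz]] := @completion_dense _ _ _ (fw_completion fw) W' _ oW'.
    by exists y.
  by exists z; split => //; exact: W'W.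
by move=> /closure_Bh/(_ n)[_ [x _ <-] /BhC]; exists x.
Qed.

Lemma continuous_Bh (f : Mb -> Mb) :
  (forall n y z, Bh n (z - y) -> Bh n (f z - f y)) -> continuous f.
Proof.
by move=> fB y W /nbhs_Bh[n nW]; apply/nbhs_Bh; exists n => z /fB/nW.
Qed.

(** * Extension of the elements of [R] to the completion *)

Lemma R0 r : R r -> r 0 = 0.
Proof. by move=> /(fw_R fw) rB; rewrite -[in LHS](subrr 0) rB subrr. Qed.

Lemma Bh_R r n x x' :
  R r -> Bh n (iota x - iota x') -> Bh n (iota (r x) - iota (r x')).
Proof.
move=> Rr; rewrite -raddfB => /Bh_iota Bx; apply: subset_closure.
by exists (r (x - x')); [exact: BR|rewrite (fw_R fw Rr) raddfB].
Qed.

(** Since [r] preserves every [B n], it sends approximations of [y] from [M] to a Cauchy sequence,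
    whose limit is the value at [y]. *)
Lemma extR_exists r : R r -> exists2 rb, Rb rb &
  forall x, rb (iota x) = iota (r x).
Proof.
move=> Rr.
(* The estimate covers every approximation [x] of [y], not just the chosen sequence; agreement with
   [r] and continuity both follow from it. *)
have ext y : exists l, forall n x, Bh n (y - iota x) -> Bh n (l - iota (r x)).
  have [u uP] := choice (iota_approx y).
  pose v k : Mb := iota (r (u k)).
  have vP n x k : Bh n (y - iota x) -> (n <= k)%N -> Bh n (v k - iota (r x)).
    move=> Byx nk; apply: Bh_R => //; apply: Bh_trans Byx.
    by apply: BhC; apply: Bh_decr nk _ (uP k).
  have [l vl] : exists l : Mb, v @ \oo --> l.
    apply: (completion_complete (fw_completion fw)) => E.
    move=> /entourage_nbhs0[U /Bh_base[n nU] UE].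
    exists ([set z | Bh n (z - v n)], [set z | Bh n (z - v n)]).
      by split; exists n => // k /= nk; exact: vP.
    move=> [a b] [/= an bn]; apply/UE/nU.
    by apply: Bh_trans bn _; exact: BhC.
  exists l => n x Byx.
  have : nbhs l [set z | Bh n (z - l)] by apply/nbhs_Bh; exists n.
  move=> /vl[N _ /(_ (maxn N n) (leq_maxl _ _)) /= /BhC Bvl].
  by apply: Bh_trans Bvl _; apply: vP => //; exact: leq_maxr.
have [rb rbP] := choice ext.
have rbi x : rb (iota x) = iota (r x).
  by apply: Bh_eq => n; apply: rbP; rewrite subrr; exact: Bh0.
exists rb => //; split; last by exists r.
apply: continuous_Bh => n y z zy; have [x Byx] := iota_approx y n.
apply: (@Bh_trans _ _ (iota (r x))); first by apply: rbP; exact: Bh_trans Byx.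
by apply: BhC; exact: rbP.
Qed.

Lemma extR_approx r rb n y x : R r -> continuous rb ->
  (forall x, rb (iota x) = iota (r x)) ->
  Bh n (y - iota x) -> Bh n (rb y - iota (r x)).
Proof.
move=> Rr rbc rbi Byx.
have : nbhs (rb y) [set w | Bh n (w - rb y)] by apply/nbhs_Bh; exists n.
(* Precision [m] lets continuity of [rb] compare [rb y] with [rb (iota x')]; precision [n] compares
   [x'] with [x]. *)
move=> /rbc/nbhs_Bh[m mn]; have [x' /BhC yx'] := iota_approx y (maxn m n).
apply: (@Bh_trans _ _ (iota (r x'))).
  by apply: BhC; rewrite -rbi; apply: mn; apply: Bh_decr yx'; exact: leq_maxl.
apply: Bh_R => //; apply: Bh_trans Byx; apply: Bh_decr yx'; exact: leq_maxr.
Qed.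

Lemma extR_Bh n rb y : Rb rb -> Bh n y -> Bh n (rb y).
Proof.
move=> [rbc [r Rr rbi]] By; have := extR_approx Rr rbc rbi (n := n) (y := y).
by move=> /(_ 0); rewrite R0// raddf0 !subr0; apply.
Qed.

Lemma extR_morph rb : Rb rb -> zmod_morphism rb.
Proof.
move=> [rbc [r Rr rbi]] y z; apply: Bh_eq => n.
have [a ya] := iota_approx y n; have [b zb] := iota_approx z n.
have rbP := extR_approx Rr rbc rbi (n := n).
apply: (@Bh_trans _ _ (iota (r (a - b)))).
  by apply: rbP; rewrite raddfB subrACA; exact: BhB.
by apply: BhC; rewrite (fw_R fw Rr) raddfB subrACA; apply: BhB; exact: rbP.
Qed.

(** * Modules, reductions and irreducible elements in the completion *)

Lemma SpanP Z : is_Rmodule Rb (Span iota R Z).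
Proof.
split=> [N [[N0 _ _] _]//|a b Sa Sb N NP|rb a Rrb Sa N NP].
  by have [[_ NB _] _] := NP; apply: NB; [exact: Sa|exact: Sb].
by have [[_ _ NR] _] := NP; apply: NR => //; exact: Sa.
Qed.

Lemma T_comm t rb a : T t -> Rb rb -> t (rb a) = rb (t a).
Proof.
move=> + Rrb; elim=> [//|{}t u Tt _ IH] /=.
by rewrite IH; exact: (congr1 (@^~ (u a)) (fw_T1_comm fw Tt Rrb)).
Qed.

Lemma T_continuous t : T t -> continuous t.
Proof.
elim=> [x|{}t u Tt _ uc x]; first exact: cvg_id.
by apply: continuous_comp; [exact: uc|exact: fw_T1_cont fw _ Tt _].
Qed.

Lemma T_morph t : T t -> zmod_morphism t.
Proof. exact: reductions_morph (fw_T1_morph fw) t. Qed.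

(** The trace of [N] on [M] is an [R]-module containing [Y], hence all of [M]; a closed set
    containing the dense image of [M] is everything. *)
Lemma closed_Rmodule_total N : is_Rmodule Rb N -> closure N `<=` N ->
  iota @` Y `<=` N -> N = setT.
Proof.
move=> [N0 NB NR] Ncl NY.
have NM : iota @^-1` N = setT.
  apply: (fw_Y fw); last by move=> y Yy; apply: NY; exists y.
  split=> [|a b Na Nb|r a Rr Na]; rewrite /= ?raddf0 ?raddfB//; first exact: NB.
  by have [rb Rrb <-] := extR_exists Rr; exact: NR.
apply/seteqP; split=> // y _; apply/Ncl/closure_Bh => n.
have [x /BhC yx] := iota_approx y n; exists (iota x) => //.
by rewrite -[N (iota x)]/((iota @^-1` N) x) NM.
Qed.

Lemma Irr_Rmodule : is_Rmodule Rb (Irr T1).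
Proof.
split=> [t Tt|a b Ia Ib t Tt|rb a Rrb Ia t Tt].
- by rewrite -[in LHS](subrr 0) (T_morph Tt) subrr.
- by rewrite (T_morph Tt) Ia// Ib.
- by rewrite T_comm// Ia.
Qed.

(** Fixed points of continuous maps into a Hausdorff space form a closed set. *)
Lemma Irr_closed : closure (Irr T1) `<=` Irr T1.
Proof.
move=> a + t Tt => /closure_Bh Ia; apply: Bh_eq => n.
have : nbhs (t a) [set w | Bh n (w - t a)] by apply/nbhs_Bh; exists n.
move=> /(T_continuous Tt)/nbhs_Bh[m mn].
have [b Ib ba] := Ia (maxn m n).
apply: (@Bh_trans _ _ b); last by apply: Bh_decr ba; exact: leq_maxr.
apply: BhC; rewrite -[X in X - _](Ib _ Tt); apply: mn.
by apply: Bh_decr ba; exact: leq_maxl.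
Qed.

Lemma fixed_Irr x : (forall t, T1 t -> t x = x) -> Irr T1 x.
Proof. by move=> tx t; elim=> [//|{}t u Tt _ ux] /=; rewrite ux tx. Qed.

(** * Reducibility modulo a module [I] of irreducible elements, and the descent *)

Section Diamond.
Context (P : M -> M -> Prop) (I : set Mb)
  (T_equi : equicontinuous_family iota B T)
  (T_compat : forall t, T t -> compatible iota R Y P t)
  (P_dcc : topological_dcc Y P)
  (I_Rmod : is_Rmodule Rb I) (I_Irr : I `<=` Irr T1)
  (I_fixed : forall mu, Y mu -> (forall t, T1 t -> t (iota mu) = iota mu) ->
    I (iota mu)).

Let I0 : I 0. Proof. by have [] := I_Rmod. Qed.
Let IB a b : I a -> I b -> I (a - b).
Proof. by have [_ + _] := I_Rmod; apply. Qed.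
Let IR rb a : Rb rb -> I a -> I (rb a).
Proof. by have [_ _] := I_Rmod; apply. Qed.

(* The largest [T]-stable subset of [Bh n]; unlike [Bh n] it is stable under
   reductions, and it is a neighbourhood of 0 by equicontinuity. *)
Definition core n : set Mb := [set x | forall t, T t -> Bh n (t x)].

(** Quantifying over all reducts [s b] allows reductions that suit different elements to be applied
    one after the other. *)
Definition reducible n : set Mb := [set b | forall s, T s ->
  exists2 t, T t & exists2 i, I i & core n (t (s b) - i)].

Lemma core_Rmodule n : is_Rmodule Rb (core n).
Proof.
split=> [t Tt|a b Va Vb t Tt|rb a Rrb Va t Tt].
- by rewrite -[X in t X](subrr 0) (T_morph Tt) subrr; exact: Bh0.
- by rewrite (T_morph Tt); apply: BhB; [exact: Va|exact: Vb].
- by rewrite T_comm//; apply: extR_Bh => //; exact: Va.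
Qed.

Lemma core_reduction n t x : T t -> core n x -> core n (t x).
Proof. by move=> Tt Vx u Tu; exact: Vx (reductions_comp Tu Tt). Qed.

Lemma Bh_core n : exists m, Bh m `<=` core n.
Proof.
have [m mP] := T_equi n; exists m => x Bx t Tt; apply: (mP _ Tt).
by exists x.
Qed.

Lemma core_reducible n : core n `<=` reducible n.
Proof.
move=> x Vx s Ts; exists id; first exact: red_id.
by exists 0 => //; rewrite subr0; exact: core_reduction.
Qed.

Lemma I_reduced n u x i : T u -> I i -> core n (x - i) -> core n (u x - i).
Proof.
move=> Tu Ii /(core_reduction Tu); rewrite (T_morph Tu).
by rewrite (I_Irr Ii).
Qed.

Lemma reducible_Rmodule n : is_Rmodule Rb (reducible n).
Proof.
have [V0 VB VR] := core_Rmodule n.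
split=> [|a b Ga Gb s Ts|rb a Rrb Ga s Ts]; first exact/core_reducible.
  have [t Tt [i Ii Vi]] := Ga s Ts.
  (* [u] is chosen for the reduct of [b] by [t \o s], so that [u \o t] serves both terms: by
     [I_reduced], applying [u] does not spoil what [t] achieved for [a]. *)
  have [u Tu [j Ij Vj]] := Gb _ (reductions_comp Tt Ts).
  exists (u \o t); first exact: reductions_comp.
  exists (i - j); first exact: IB.
  rewrite /= (T_morph Ts) (T_morph Tt) (T_morph Tu) subrACA.
  by apply: VB => //; exact: I_reduced.
have [t Tt [i Ii Vi]] := Ga s Ts.
exists t => //; exists (rb i); first exact: IR.
by rewrite (T_comm _ Ts)// (T_comm _ Tt)// -(extR_morph Rrb); exact: VR.
Qed.

(** A subgroup containing the neighbourhood [Bh m] of 0 is open, hence closed. *)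
Lemma reducible_closed n : closure (reducible n) `<=` reducible n.
Proof.
have [m mV] := Bh_core n; have [_ GB _] := reducible_Rmodule n.
move=> a /closure_Bh/(_ m)[b Gb /mV/core_reducible Gba].
by rewrite -(subKr b a); exact: GB.
Qed.

Lemma DSM_reducible n mu : Y mu ->
  (forall nu, Y nu -> strict P nu mu -> reducible n (iota nu)) ->
  DSM iota R Y P mu `<=` reducible n.
Proof.
move=> Ymu below a Da; apply: reducible_closed; move: a Da.
apply: closureS; apply: smallest_sub; first exact: reducible_Rmodule.
by move=> _ [nu [Ynu numu] <-]; exact: below.
Qed.

Lemma reducible_step n mu : Y mu -> ~ reducible n (iota mu) ->
  exists nu, [/\ Y nu, ~ reducible n (iota nu) & strict P nu mu].
Proof.
move=> Ymu; apply: contra_notP => /forallNP none.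
have {none}/(DSM_reducible Ymu) Dmu : forall nu, Y nu -> strict P nu mu ->
    reducible n (iota nu).
  by move=> nu Ynu numu; apply: contrapT => Gnu; exact: (none nu).
have [Imu|] := pselect (forall t, T1 t -> t (iota mu) = iota mu).
  move=> s Ts; exists id; first exact: red_id.
  exists (iota mu); first exact: I_fixed.
  have -> : s (iota mu) = iota mu by exact: fixed_Irr Ts.
  by rewrite subrr; have [] := core_Rmodule n.
move=> /existsNP[t /not_implyP[Tt tmu]].
have TTt : T t by apply: (red_comp Tt); exact: red_id.
(* Either [s] already sends [iota mu] into the reducible [DSM], or it fixes it; then [t], which
   moves it, sends it there. *)
move=> s Ts; case: (T_compat Ts Ymu) => [/= ->|/Dmu/(_ id)]; last first.
  by apply; exact: red_id.
case: (T_compat TTt Ymu) => // /Dmu/(_ id (red_id _))[u Tu [i Ii ui]].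
exists (u \o t); first exact: reductions_comp.
by exists i.
Qed.

Lemma all_reducible n : reducible n = setT.
Proof.
apply: closed_Rmodule_total (reducible_Rmodule n) (@reducible_closed n) _.
move=> _ [mu0 Ymu0 <-]; apply: contrapT => Gmu0.
(* Bundling the proofs into the type lets a choice function for [reducible_step] be iterated. *)
pose bad := {mu | Y mu /\ ~ reducible n (iota mu)}.
have next (x : bad) : exists y : bad, strict P (sval y) (sval x).
  case: x => x [Yx Gx]; have [y [Yy Gy yx]] := reducible_step Yx Gx.
  by exists (exist _ y (conj Yy Gy)).
have [f fP] := choice next.
pose mu k := sval (iter k f (exist _ mu0 (conj Ymu0 Gmu0))).
have Ymu k : Y (mu k) by exact: (svalP (iter k f _)).1.
have Gmu k : ~ reducible n (iota (mu k)) by exact: (svalP (iter k f _)).2.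
have [m mV] := Bh_core n.
(* The chain tends to 0, so some [mu k] enters [B m]; its image then lies in [core n], where
   everything is reducible. *)
have := P_dcc Ymu (fun k => fP _) (B_nbhs m) => -[k _ /(_ k (leqnn k)) /= Bk].
apply: (Gmu k); apply/core_reducible/mV/subset_closure.
by exists (mu k).
Qed.

Lemma Irr_sub_closure : Irr T1 `<=` closure I.
Proof.
move=> a Ia; apply/closure_Bh => n.
have : reducible n a by rewrite all_reducible.
(* With [s = id] and [t a = a], membership of [a - i] in [core n], tested at the identity, puts [i]
   within [Bh n] of [a]. *)
move=> /(_ id (red_id _))[t Tt [i Ii]]; rewrite /= (Ia t Tt).
by move=> /(_ id (red_id _))/BhC; exists i.
Qed.

End Diamond.
End FrameworkTheory.

Theorem theorem5p6 (M : topologicalZmodType) (Mb : UniformZmodule.type)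
    (iota : {additive M -> Mb}) (R : set (M -> M)) (Y : set M)
    (B : nat -> set M) (T1 : set (Mb -> Mb)) (P : M -> M -> Prop) :
  framework iota R Y B T1 ->
  partial_order_on Y P ->
  equicontinuous_family iota B (reductions T1) ->
  (forall t, reductions T1 t -> compatible iota R Y P t) ->
  topological_dcc Y P ->
  Irr T1 =
    Cspan iota R
      (iota @` [set mu | Y mu /\ forall t, T1 t -> t (iota mu) = iota mu]).
Proof.
move=> fw _ equi compat dcc; set Z := iota @` _.
have Span_Irr : Span iota R Z `<=` Irr T1.
  apply: smallest_sub; first exact: Irr_Rmodule fw.
  by move=> _ [mu [_ fix_mu] <-]; exact: fixed_Irr.
apply/seteqP; split.
  (* The module [I] is taken to be the span of [Z], whose closure is the right-hand side. *)
  have := Irr_sub_closure fw equi compat dcc (SpanP _ _ _) Span_Irr.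
  apply=> mu Ymu fix_mu.
  by apply: sub_gen_smallest; exists mu.
by move=> a Ca; apply: (Irr_closed fw); apply: closureS Ca.
Qed.
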